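(* Let $K$ be a p.c.f. self-similar set determined by contractive similitudes $P_1,\dots,P_N$, equipped with an energy $\mathcal{E}$ with respect to positive reals $\{c_{ij}\}_{1\le i<j\le N_0}$ and $\{r_i\}_{1\le i\le N}$ (so that the compatibility condition $\mathcal{E}_{m-1}(u)=\min\mathcal{E}_m(\widetilde u)$ stated in the context holds). Let $f:K\to\mathbb{R}$ be the fractal interpolation function defined by a basic function $B:V_1\to\mathbb{R}$ and vertical scaling factors $d_1,\dots,d_N\in(-1,1)$. Then $\mathcal{E}(f)<\infty$ if and only if either $\mathcal{E}_1(f)=\mathcal{E}_0(f)$ or $\sum_{k=1}^N r_k^{-1}d_k^2<1$. Furthermore, in case $\mathcal{E}_1(f)=\mathcal{E}_0(f)$, $f$ is a harmonic function, so that $\mathcal{E}(f)=\mathcal{E}_0(f)$; and in case $\sum_{k=1}^N r_k^{-1}d_k^2<1$, $$\mathcal{E}(f)=\mathcal{E}_0(f)+\frac{1}{1-\left(\sum_{k=1}^N r_k^{-1}d_k^2\right)}\bigl(\mathcal{E}_1(f)-\mathcal{E}_0(f)\bigr).$$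
   Context: Self-similar set and words. Let $P_1,\dots,P_N$ be contractive similitudes of $\mathbb{R}^n$ and $K$ the unique nonempty compact set with $K=\bigcup_{i=1}^N P_i(K)$. Put $\Sigma_N=\{1,\dots,N\}$; $\Sigma_N^m$ is the set of words $\omega=\omega_1\cdots\omega_m$ of length $|\omega|=m$ with letters in $\Sigma_N$, and $\Sigma_N^0$ consists of the empty word. For $\omega\in\Sigma_N^m$ let $P_\omega=P_{\omega_1}\circ\cdots\circ P_{\omega_m}$ (the identity for the empty word). Let $q_i$ be the fixed point of $P_i$. P.c.f. The set $K$ is post critically finite (p.c.f.) if $K$ is connected and there is a finite set $V_0\subset K$, called the boundary, such that $P_\omega(K)\cap P_{\omega'}(K)=P_\omega(V_0)\cap P_{\omega'}(V_0)$ for all $\omega\ne\omega'$ with $|\omega|=|\omega'|$, with this intersection disjoint from $V_0$; moreover $V_0$ is required to be the minimum subset of $\{q_1,\dots,q_N\}$ satisfying this condition. Without loss of generality $V_0=\{q_1,\dots,q_{N_0}\}$ with $N_0\le N$. For $m\ge1$ let $V_m=\bigcup_{|\omega|=m}P_\omega(V_0)$, and $V_*=\bigcup_{m\ge1}V_m$. Energy. Let $c_{ij}>0$ ($1\le i<j\le N_0$) and $r_i>0$ ($1\le i\le N$), and $r_\omega=r_{\omega_1}\cdots r_{\omega_m}$ for $\omega\in\Sigma_N^m$ (with $r_\omega=1$ for the empty word). For $m\ge0$ and a function $u$ on $V_m$ (or on a larger set), define $$\mathcal{E}_m(u)=\sum_{\omega\in\Sigma_N^m}\sum_{1\le i<j\le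 N_0}r_\omega^{-1}c_{ij}\bigl(u(P_\omega q_i)-u(P_\omega q_j)\bigr)^2 .$$ Standing assumption (the energy is well defined): for all $m\ge1$ and all $u:K\to\mathbb{R}$, $\mathcal{E}_{m-1}(u)=\min\mathcal{E}_m(\widetilde u)$, where the minimum is over all $\widetilde u$ on $V_m$ with $\widetilde u|_{V_{m-1}}=u|_{V_{m-1}}$. Then $\mathcal{E}_m(u)$ is increasing in $m$ and the energy of $u$ is $\mathcal{E}(u)=\lim_{m\to\infty}\mathcal{E}_m(u)\in[0,\infty]$. A function $u$ is called harmonic if $\mathcal{E}_{m-1}(u)=\mathcal{E}_m(u)$ for all $m\ge1$. Fractal interpolation function (FIF). Given $B:V_1\to\mathbb{R}$ and $d_1,\dots,d_N\in(-1,1)$, it is known that there is a unique continuous function $f:K\to\mathbb{R}$ with $f|_{V_1}=B$ such that $f(P_i(x))=d_if(x)+h_i(x)$ for all $x\in K$ and $i\in\Sigma_N$, where each $h_i$ is a harmonic function on $K$. This $f$ is the fractal interpolation function defined by the basic function $B$ and the vertical scaling factors $d_i$. *)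

(* Defs.v *)
From HB Require Import structures.
From mathcomp Require Import all_boot all_order all_algebra.
From mathcomp Require Import all_classical all_reals all_analysis.

Set Implicit Arguments.
Unset Strict Implicit.
Unset Printing Implicit Defensive.

Import Order.TTheory GRing.Theory Num.Theory.
Import numFieldNormedType.Exports.

Local Open Scope classical_set_scope.
Local Open Scope ring_scope.

Section SelfSimilar.
Context {R : realType} {n : nat}.
Local Notation E := 'rV[R]_n.

(* The library norm on row vectors is the sup norm; similitudes refer to the
   Euclidean one.  Both induce the library topology on 'rV[R]_n. *)
Definition enorm (x : E) : R := Num.sqrt (\sum_i x ord0 i ^+ 2).

Definition contractive_similitude (T : E -> E) : Prop :=
  exists s : R, 0 < s < 1 /\
    forall x y, enorm (T x - T y) = s * enorm (x - y).

(* Letters are numbered from 0, so that {1, ..., N} becomes 'I_N. *)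
Context {N : nat}.
Implicit Types (P : 'I_N -> E -> E) (q : 'I_N -> E) (K V : set E).

Definition is_self_similar_set P K : Prop :=
  [/\ K !=set0, compact K & K = \bigcup_i (P i @` K)].

Definition word_map P (w : seq 'I_N) : E -> E :=
  foldr (fun i g => P i \o g) idfun w.

Definition boundary_condition P K V : Prop :=
  forall (m : nat) (w w' : m.-tuple 'I_N), w != w' ->
    (word_map P w @` K) `&` (word_map P w' @` K)
      = (word_map P w @` V) `&` (word_map P w' @` V) /\
    ((word_map P w @` K) `&` (word_map P w' @` K)) `&` V = set0.

(* "Minimum" means least for inclusion among the subsets of {q_1, ..., q_N}
   satisfying the condition. *)
Definition is_pcf P q K V0 : Prop :=
  [/\ connected K,
      finite_set V0 /\ V0 `<=` K,
      boundary_condition P K V0,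
      V0 `<=` range q &
      forall V, V `<=` range q -> boundary_condition P K V -> V0 `<=` V].

Definition boundary q (N0 : nat) : set E := q @` [set i : 'I_N | (i < N0)%N].

Definition vertices P q (N0 m : nat) : set E :=
  \bigcup_(w in [set: m.-tuple 'I_N]) (word_map P w @` boundary q N0).

(* Functions on K or on vertices are represented by total functions E -> R of
   which only the values on K, respectively on the vertices, matter. *)
Implicit Types (u f h : E -> R) (c : 'I_N -> 'I_N -> R) (r d : 'I_N -> R).

Definition word_weight r (w : seq 'I_N) : R := \prod_(k <- w) r k.

(* Only the c i j with i < j < N0 are used. *)
Definition level_energy P q N0 c r (m : nat) u : R :=
  \sum_(w : m.-tuple 'I_N)
    \sum_(i < N | (i < N0)%N) \sum_(j < N | (i < j < N0)%N)
      (word_weight r w)^-1 * c i j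
        * (u (word_map P w (q i)) - u (word_map P w (q j))) ^+ 2.

Definition energy_compatible P q N0 c r : Prop :=
  forall (m : nat) u, (1 <= m)%N ->
    let extensions := [set v : E -> R | {in vertices P q N0 m.-1, v =1 u}] in
    (exists2 v, extensions v &
       level_energy P q N0 c r m v = level_energy P q N0 c r m.-1 u) /\
    (forall v, extensions v ->
       level_energy P q N0 c r m.-1 u <= level_energy P q N0 c r m v).

Definition energy P q N0 c r u : \bar R :=
  limn (fun m => (level_energy P q N0 c r m u)%:E).

Definition harmonic_function P q N0 c r u : Prop :=
  forall m : nat, (1 <= m)%N ->
    level_energy P q N0 c r m.-1 u = level_energy P q N0 c r m u.

Definition is_fif P q K N0 c r (B : E -> R) d f : Prop :=
  [/\ {within K, continuous f},
      {in vertices P q N0 1, f =1 B} &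
      exists h : 'I_N -> E -> R,
        (forall i, harmonic_function P q N0 c r (h i)) /\
        forall i, {in K, forall x, f (P i x) = d i * f x + h i x}].

End SelfSimilar.

(* Main.v *)
Require Import Defs.
From HB Require Import structures.
From mathcomp Require Import all_boot all_order all_algebra.
From mathcomp Require Import all_classical all_reals all_analysis.
From mathcomp Require Import ring lra.
Import Order.TTheory GRing.Theory Num.Theory.
Import numFieldNormedType.Exports.
Local Open Scope classical_set_scope.
Local Open Scope ring_scope.

(** The level energies of [f] satisfy an affine recurrence, so that they are
    partial sums of a geometric series of ratio
    [rho = \sum_k (r k)^-1 * d k ^+ 2].

    Splitting off the first letter of each word shows that the energy of level
    [m.+1] of [f] is the sum over [i] of [(r i)^-1] times the energy of level
    [m] of [f \o P i] ([level_energyS]).  On the vertices, which lie in [K],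
    [f \o P i] is [d i * f + h i]; expanding the square gives [rho] times the
    energy of level [m] of [f], plus terms in the energy of [h i] and in the
    mixed form of [f] and [h i].  Neither of these depends on [m], because
    [h i] is harmonic: for the mixed form this is [level_form_harmonic], a
    consequence of the growth of energies with the level.  Hence the increments
    of the sequence of energies are multiplied by [rho] at each level
    ([fif_increment]).

    The first increment is nonnegative and [rho >= 0].  If the first increment
    vanishes, all do; otherwise the geometric series converges exactly when
    [rho < 1], with the sum given in the theorem. *)

(** * The energy of level [m] as a quadratic form *)

Section LevelForm.
Context {R : realType} {n N : nat}.
Variables (P : 'I_N -> 'rV[R]_n -> 'rV[R]_n) (q : 'I_N -> 'rV[R]_n) (N0 : nat).
Variables (c : 'I_N -> 'I_N -> R) (r : 'I_N -> R).
Implicit Types u v f h : 'rV[R]_n -> R.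

Local Notation energy_at := (level_energy P q N0 c r).

Definition level_form (m : nat) u v : R :=
  \sum_(w : m.-tuple 'I_N)
    \sum_(i < N | (i < N0)%N) \sum_(j < N | (i < j < N0)%N)
      (word_weight r w)^-1 * c i j
        * ((u (word_map P w (q i)) - u (word_map P w (q j)))
           * (v (word_map P w (q i)) - v (word_map P w (q j)))).

Lemma level_energy_lincomb m a b u v :
  energy_at m (fun x => a * u x + b * v x) =
  a ^+ 2 * energy_at m u + (2 * a * b) * level_form m u v
  + b ^+ 2 * energy_at m v.
Proof.
rewrite /level_energy /level_form !mulr_sumr -!big_split /=.
apply: eq_bigr => w _; rewrite !mulr_sumr -!big_split /=.
apply: eq_bigr => i _; rewrite !mulr_sumr -!big_split /=.
by apply: eq_bigr => j _; ring.
Qed.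

(** The words of length [m.+1] with first letter [i] are the [i :: w], whose
    map is [P i \o word_map P w] and whose weight is [r i] times that of [w]. *)
Lemma level_energyS m u :
  energy_at m.+1 u = \sum_i (r i)^-1 * energy_at m (u \o P i).
Proof.
rewrite /level_energy.
under [RHS]eq_bigr do rewrite mulr_sumr.
rewrite pair_bigA /=.
rewrite (reindex (fun p : 'I_N * m.-tuple 'I_N => [tuple of p.1 :: p.2])) /=;
  last first.
  exists (fun w : m.+1.-tuple 'I_N => (thead w, [tuple of behead w])).
    by move=> [i w] _; congr pair; apply: val_inj.
  by move=> w _; rewrite [RHS]tuple_eta.
apply: eq_bigr => -[k w] _ /=; rewrite mulr_sumr.
apply: eq_bigr => i _; rewrite mulr_sumr; apply: eq_bigr => j _.
by rewrite /word_weight big_cons invfM -!mulrA.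
Qed.

(** * Consequences of compatibility and harmonicity *)

Hypothesis compat : energy_compatible P q N0 c r.

(** A function is one of its own extensions, hence a competitor in the
    minimum. *)
Lemma level_energy_leS m u : energy_at m u <= energy_at m.+1 u.
Proof. by have [_] := compat m.+1 u isT; apply. Qed.

Lemma harmonic_level_energy m h : harmonic_function P q N0 c r h ->
  energy_at m h = energy_at 0 h.
Proof. by move=> hh; elim: m => // m <-; rewrite [RHS](hh m.+1). Qed.

(** As a function of [t], the increment of energy of [u + t * h] between two
    consecutive levels is nonnegative; its quadratic coefficient is the
    increment of energy of [h], which is zero.  A nonnegative affine function
    is constant, and its slope is twice the increment of the mixed form. *)
Lemma level_form_harmonic m u h : harmonic_function P q N0 c r h ->
  level_form m u h = level_form 0 u h.
Proof.
move=> hh; elim: m => // m <-.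
set D := level_form m.+1 u h - level_form m u h.
set A := energy_at m.+1 u - energy_at m u.
have nneg t : 0 <= A + 2 * t * D.
  have := level_energy_leS m (fun x => 1 * u x + t * h x).
  rewrite !level_energy_lincomb -(hh m.+1 isT) -subr_ge0 /=.
  by rewrite /A /D; congr (0 <= _); ring.
apply/eqP; rewrite -subr_eq0 -/D; apply/negPn/negP => D0.
(* a value of t at which the affine function A + 2 t D takes the value -1 *)
have := nneg (- (A + 1) / (2 * D)).
have -> : A + 2 * (- (A + 1) / (2 * D)) * D = -1 by field.
by rewrite lerNr oppr0 ler10.
Qed.

(** * The recurrence for the energies of an interpolation function *)

Variables (K : set 'rV[R]_n) (d : 'I_N -> R).
Hypothesis K_ss : is_self_similar_set P K.
Hypothesis boundaryK : boundary q N0 `<=` K.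

Lemma word_map_in w x : K x -> K (word_map P w x).
Proof.
have [_ _ KE] := K_ss.
move=> Kx; elim: w => //= i w Kw.
by rewrite KE; exists i => //; exists (word_map P w x).
Qed.

(** The functional equation of an interpolation function is known on [K] only;
    this allows it to be used inside a level energy. *)
Lemma eq_level_energy m u v : {in K, u =1 v} -> energy_at m u = energy_at m v.
Proof.
move=> uv; have vertex_eq w (i : 'I_N) : (i < N0)%N ->
    u (word_map P w (q i)) = v (word_map P w (q i)).
  by move=> i0; apply/uv/mem_set/word_map_in/boundaryK; exists i.
apply: eq_bigr => w _; apply: eq_bigr => i i0; apply: eq_bigr => j /andP[_ j0].
by rewrite !vertex_eq.
Qed.

(** The energies satisfy [E m.+1 = rho * E m + C], where the constant [C] is
    made of the energies of the [h i] and their mixed forms with [f], evaluated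
    at level [0] since they are the same at every level.  Taking differences
    eliminates [C]. *)
Lemma fif_increment f (h : 'I_N -> 'rV[R]_n -> R) m :
  (forall i, harmonic_function P q N0 c r (h i)) ->
  (forall i, {in K, forall x, f (P i x) = d i * f x + h i x}) ->
  energy_at m.+1 f - energy_at m f =
  (\sum_i (r i)^-1 * d i ^+ 2) ^+ m * (energy_at 1 f - energy_at 0 f).
Proof.
move=> hh fP; set rho := \sum_i _.
pose C := \sum_i (r i)^-1 * (2 * d i * level_form 0 f (h i)
                             + energy_at 0 (h i)).
have rec k : energy_at k.+1 f = rho * energy_at k f + C.
  rewrite level_energyS mulr_suml -big_split /=; apply: eq_bigr => i _.
  rewrite (@eq_level_energy _ _ (fun x => d i * f x + 1 * h i x)); last first.
    by move=> x Kx /=; rewrite fP // mul1r.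
  rewrite level_energy_lincomb (level_form_harmonic _ _ _ (hh i)).
  rewrite (harmonic_level_energy _ _ (hh i)).
  by ring.
elim: m => [|m IH]; first by rewrite expr0 mul1r.
rewrite exprS -mulrA -IH mulrBr -[rho * energy_at m f](addrK C) -rec rec.
by ring.
Qed.

End LevelForm.

(** * Sequences with geometric increments *)

Section GeometricIncrements.
Context {R : realType}.
Variables (a : R^nat) (rho : R).
Hypothesis a_incr : forall m, a m.+1 - a m = rho ^+ m * (a 1%N - a 0%N).

Lemma geometric_increments_lim : 0 <= rho < 1 ->
  limn (EFin \o a) = (a 0%N + 1 / (1 - rho) * (a 1%N - a 0%N))%:E.
Proof.
move=> /andP[rho0 rho1]; have rhoN1 : 1 - rho != 0 by rewrite subr_eq0 gt_eqF.
have aE m : a m = a 0%N + (1 - rho ^+ m) / (1 - rho) * (a 1%N - a 0%N).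
  elim: m => [|m IH]; first by rewrite expr0 subrr !mul0r addr0.
  rewrite -[LHS](subrK (a m)) (a_incr m) IH exprS.
  by field.
apply/cvg_lim => //; apply: cvg_EFin; first by near=> m.
rewrite [X in X @ _ --> _](_ : _ = fun m =>
  a 0%N + (1 - rho ^+ m) / (1 - rho) * (a 1%N - a 0%N)); last exact/funext.
apply: cvgD; first exact: cvg_cst.
apply: cvgMl; apply: cvgMl.
rewrite -[X in _ --> X]subr0; apply: cvgB; first exact: cvg_cst.
by apply: cvg_expr; rewrite ger0_norm.
Unshelve. all: by end_near. Qed.

(** If [rho >= 1], every increment is at least the first one, so that a
    positive first increment forces linear growth. *)
Lemma geometric_increments_lim_lty : a 0%N <= a 1%N -> 0 <= rho ->
  (limn (EFin \o a) < +oo)%E -> a 1%N = a 0%N \/ rho < 1.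
Proof.
move=> a01 rho0 lim_fin.
have [rho1|rho1] := ltP rho 1; [by right|left].
apply/eqP; rewrite eq_le a01 andbT leNgt; apply/negP => a01'.
set D := a 1%N - a 0%N; have D0 : 0 < D by rewrite subr_gt0.
have a_ge m : a 0%N + D *+ m <= a m.
  elim: m => [|m IH]; first by rewrite mulr0n addr0.
  rewrite -[a m.+1](subrK (a m)) (a_incr m) -/D mulrSr addrA [leRHS]addrC.
  by rewrite lerD // ler_peMl ?exprn_ege1 ?(ltW D0).
have ndec : nondecreasing_seq (EFin \o a).
  apply/nondecreasing_seqP => m; rewrite lee_fin -subr_ge0 a_incr.
  by rewrite mulr_ge0 ?exprn_ge0 // ltW.
have le_lim m : ((a m)%:E <= limn (EFin \o a))%E.
  rewrite (cvg_lim _ (ereal_nondecreasing_cvgn ndec)) //.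
  by apply: ereal_sup_ubound; exists m.
case: (limn _) lim_fin le_lim => [l _ le_l | // | _ /(_ 0%N) //].
have la0 : 0 <= l - a 0%N by rewrite subr_ge0 -lee_fin.
have := archi_boundP (divr_ge0 la0 (ltW D0)); set m := Num.bound _.
rewrite ltr_pdivrMr // mulr_natl => lt_m.
have := le_l m; rewrite lee_fin => le_m.
have := a_ge m; lra.
Qed.

End GeometricIncrements.

Theorem theorem2p2 (R : realType) (n N N0 : nat)
    (P : 'I_N -> 'rV[R]_n -> 'rV[R]_n) (q : 'I_N -> 'rV[R]_n)
    (K : set 'rV[R]_n)
    (c : 'I_N -> 'I_N -> R) (r : 'I_N -> R)
    (B : 'rV[R]_n -> R) (d : 'I_N -> R) (f : 'rV[R]_n -> R)
    (P_sim : forall i, contractive_similitude (P i))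
    (K_ss : is_self_similar_set P K)
    (q_fix : forall i, P i (q i) = q i)
    (N0_le : (N0 <= N)%N)
    (K_pcf : is_pcf P q K (boundary q N0))
    (c_gt0 : forall i j : 'I_N, (i < j < N0)%N -> 0 < c i j)
    (r_gt0 : forall i, 0 < r i)
    (E_compat : energy_compatible P q N0 c r)
    (d_bound : forall i, -1 < d i < 1)
    (f_fif : is_fif P q K N0 c r B d f) :
  let E0 := level_energy P q N0 c r 0 f in
  let E1 := level_energy P q N0 c r 1 f in
  let Ef := energy P q N0 c r f in
  let rho := \sum_(k < N) (r k)^-1 * d k ^+ 2 in
  [/\ (Ef < +oo)%E <-> (E1 = E0 \/ rho < 1),
      E1 = E0 -> harmonic_function P q N0 c r f /\ Ef = E0%:E &
      rho < 1 -> Ef = (E0 + 1 / (1 - rho) * (E1 - E0))%:E].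
Proof.
move=> E0 E1 Ef rho.
have [_ [_ boundaryK] _ _ _] := K_pcf.
have [_ _ [h [h_harm fP]]] := f_fif.
have incr m := @fif_increment _ _ _ _ _ _ _ _ E_compat _ _ K_ss boundaryK
  f h m h_harm fP.
have rho0 : 0 <= rho.
  by apply: sumr_ge0 => k _; rewrite mulr_ge0 ?sqr_ge0 // invr_ge0 ltW.
have E01 : E0 <= E1 by exact: level_energy_leS.
have harm_case : E1 = E0 -> harmonic_function P q N0 c r f /\ Ef = E0%:E.
  move=> E10.
  have f_harm : harmonic_function P q N0 c r f.
    case=> // m _ /=; apply/esym/eqP.
    by rewrite -subr_eq0 incr -/E1 -/E0 E10 subrr mulr0.
  split=> //; apply: cvg_lim => //; rewrite [X in X @ _ --> _](_ : _ = cst E0%:E).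
    exact: cvg_cst.
  by apply/funext => m; rewrite /= harmonic_level_energy.
have contr_case : rho < 1 -> Ef = (E0 + 1 / (1 - rho) * (E1 - E0))%:E.
  by move=> rho1; apply: (geometric_increments_lim _ _ incr); rewrite rho0.
split=> //; split; first exact: (geometric_increments_lim_lty _ _ incr).
by case=> [/harm_case [_ ->] | /contr_case ->]; exact: ltry.
Qed.
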